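(* Let $\lambda$ be a partition with $|\lambda|\equiv0\pmod 2$. Then $N_{\lambda,\lambda,\lambda}>0$ if and only if $N_{k\lambda,k\lambda,k\lambda}>0$ for all $k\in{\mathbb Z}_{\ge1}$.
   Context: For a partition $\lambda=(\lambda_1,\lambda_2,\ldots)$, $k\lambda=(k\lambda_1,k\lambda_2,\ldots)$ and $|\lambda|=\sum_i\lambda_i$. With $c_{\alpha,\beta}^{\mu}$ the Littlewood-Richardson coefficient ($s_\alpha s_\beta=\sum_\mu c_{\alpha,\beta}^\mu s_\mu$), the Newell-Littlewood number is $$N_{\mu,\nu,\lambda}=\sum_{\alpha,\beta,\gamma} c_{\alpha,\beta}^{\mu}c_{\alpha,\gamma}^{\nu}c_{\beta,\gamma}^{\lambda},$$ the sum over all triples of partitions (finitely many nonzero terms). *)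

(* Defs.v *)
From mathcomp Require Import all_boot all_order all_algebra.
From mathcomp Require Import mpoly.
From Stdlib Require Import ClassicalEpsilon.

Set Implicit Arguments.
Unset Strict Implicit.
Unset Printing Implicit Defensive.

Import Order.TTheory GRing.Theory Num.Theory.
Local Open Scope ring_scope.

(* A partition is the sequence of its nonzero parts, without trailing zeros,
   so that equality of partitions is equality of sequences. *)
Definition is_part (la : seq nat) : bool := sorted geq la && (0%N \notin la).

(* For k = 0 the result has zero entries and is not a partition in this
   encoding unless la is empty. *)
Definition scale_part (k : nat) (la : seq nat) : seq nat :=
  [seq (k * x)%N | x <- la].

Lemma is_part_scale (k : nat) (la : seq nat) :
  (0 < k)%N -> is_part la -> is_part (scale_part k la).
Proof.
move=> k0 /andP[sla pla]; apply/andP; split.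
  rewrite /scale_part sorted_map; apply: sub_sorted sla => x y /= le_yx.
  by rewrite /geq /= leq_mul2l [(y <= x)%N]le_yx orbT.
apply/mapP => -[x xla] /eqP; rewrite eq_sym muln_eq0 -[k == _]negbK -lt0n k0 /=.
by move/eqP=> x0; rewrite -x0 xla in pla.
Qed.

(* All partitions with at most k parts, each of them at most m. *)
Fixpoint part_box (k m : nat) : seq (seq nat) :=
  if k is k'.+1 then
    [::] :: flatten [seq [seq i :: s | s <- part_box k' i] | i <- iota 1 m]
  else [:: [::]].

Definition parts_of (d : nat) : seq (seq nat) :=
  [seq la <- part_box d d | sumn la == d].

Definition parts_upto (d : nat) : seq (seq nat) :=
  [seq la <- part_box d d | (sumn la <= d)%N].

Lemma mem_part_box (k m : nat) (la : seq nat) :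
  (la \in part_box k m) =
  [&& is_part la, (size la <= k)%N & all (fun x => (x <= m)%N) la].
Proof.
elim: k m la => [|k IHk] m [|x la] //=; first by rewrite /= inE andbF.
rewrite in_cons /=; apply/flatten_mapP/idP.
  case=> i; rewrite mem_iota add1n ltnS => /andP[i0 im] /mapP[s].
  rewrite IHk => /and3P[/andP[ss ps] szs als] [-> ->].
  rewrite /is_part /= in_cons negb_or ps eq_sym -lt0n i0 ltnS szs im /= andbT.
  apply/andP; split; first by rewrite (path_sortedE (rev_trans leq_trans)) ss andbT.
  by apply: sub_all als => y yi; apply: leq_trans im.
case/and3P=> /andP[/= pla]; rewrite in_cons negb_or [0%N == x]eq_sym -lt0n ltnS.
move=> /andP[x0 nla] sz /andP[xm _].
exists x; first by rewrite mem_iota x0 add1n ltnS.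
apply/mapP; exists la => //; rewrite IHk sz /is_part nla andbT /=.
by move: pla; rewrite (path_sortedE (rev_trans leq_trans)) => /andP[-> ->].
Qed.

Lemma part_box_uniq (k m : nat) : uniq (part_box k m).
Proof.
elim: k m => [|k IHk] m //=; apply/andP; split.
  by apply/flatten_mapP => -[i _ /mapP[]].
apply: (@allpairs_uniq_dep _ (fun=> seq nat) _ (fun i s => i :: s)) => //.
- exact: iota_uniq.
- by move=> [i s] [j t] _ _ [-> ->].
Qed.

Lemma is_part_in_box (d : nat) (la : seq nat) :
  is_part la -> (sumn la <= d)%N -> la \in part_box d d.
Proof.
move=> pla; rewrite mem_part_box pla /=; case/andP: pla => _.
elim: la d => [|x la IHla] d //=; rewrite in_cons negb_or [0%N == x]eq_sym -lt0n => /andP[x0 nla] le_d.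
have /(IHla _ nla)/andP[sz al] : (sumn la <= d - x)%N by rewrite leq_subRL ?(leq_trans _ le_d) ?leq_addr.
have xd : (x <= d)%N by apply: leq_trans le_d; apply: leq_addr.
rewrite xd (leq_ltn_trans sz) /=; last by rewrite ltn_subrL x0 (leq_trans x0).
by apply: sub_all al => y /leq_trans-> //; apply: leq_subr.
Qed.

Lemma mem_parts_of (d : nat) (la : seq nat) :
  (la \in parts_of d) = is_part la && (sumn la == d).
Proof.
rewrite mem_filter andbC; have [eqd|] := eqVneq (sumn la) d; last by rewrite !andbF.
rewrite !andbT; apply/idP/idP; first by rewrite mem_part_box => /and3P[].
by move/is_part_in_box; apply; rewrite eqd.
Qed.

Lemma mem_parts_upto (d : nat) (la : seq nat) :
  (la \in parts_upto d) = is_part la && (sumn la <= d)%N.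
Proof.
rewrite mem_filter andbC; have [led|] := boolP (sumn la <= d)%N; last by rewrite !andbF.
rewrite !andbT; apply/idP/idP; first by rewrite mem_part_box => /and3P[].
by move/is_part_in_box; apply.
Qed.

Lemma parts_of_uniq (d : nat) : uniq (parts_of d).
Proof. exact/filter_uniq/part_box_uniq. Qed.

Lemma parts_upto_uniq (d : nat) : uniq (parts_upto d).
Proof. exact/filter_uniq/part_box_uniq. Qed.

(* The cell in row i and column j of the Young diagram is the pair of i and j. *)
Definition cell (la : seq nat) : finType :=
  {i : 'I_(size la) & 'I_(nth 0%N la i)}.

Definition cell_row (la : seq nat) (c : cell la) : nat := tag c.
Definition cell_col (la : seq nat) (c : cell la) : nat := tagged c.

Definition semistandard (n : nat) (la : seq nat) (T : {ffun cell la -> 'I_n}) :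
    bool :=
  [forall c : cell la, forall c' : cell la,
    ((cell_row c == cell_row c') && (cell_col c < cell_col c')%N
       ==> (T c <= T c')%N) &&
    ((cell_col c == cell_col c') && (cell_row c < cell_row c')%N
       ==> (T c < T c')%N)].

(* The Schur polynomial s_la(x_0, ..., x_(n-1)). *)
Definition schur (n : nat) (la : seq nat) : {mpoly int[n]} :=
  \sum_(T : {ffun cell la -> 'I_n} | semistandard T) \prod_(c : cell la) 'X_(T c).

(* The identity s_al s_be = \sum_mu c_mu s_mu between Schur functions, that is,
   between Schur polynomials in every number n of variables.  By homogeneity
   only the partitions mu of |al| + |be| occur; on these c is determined, since
   their Schur polynomials are linearly independent once n >= |al| + |be|. *)
Definition schur_expansion (al be : seq nat) (c : seq nat -> int) : Prop :=
  forall n : nat,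
    schur n al * schur n be =
    \sum_(mu <- parts_of (sumn al + sumn be)) c mu *: schur n mu.

Definition LRcoef (al be mu : seq nat) : int :=
  if mu \in parts_of (sumn al + sumn be) then
    epsilon (inhabits (fun=> 0)) (schur_expansion al be) mu
  else 0.

(* The ranges contain every triple with a nonzero term: see NLnum_support. *)
Definition NLnum (mu nu la : seq nat) : int :=
  \sum_(al <- parts_upto (sumn mu)) \sum_(be <- parts_upto (sumn mu))
    \sum_(ga <- parts_upto (sumn nu))
      LRcoef al be mu * LRcoef al ga nu * LRcoef be ga la.

Lemma LRcoef_neq0 (al be mu : seq nat) :
  LRcoef al be mu != 0 -> sumn mu = (sumn al + sumn be)%N.
Proof.
rewrite /LRcoef mem_parts_of; case: ifP => [/andP[_ /eqP]//|_].
by rewrite eqxx.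
Qed.

Lemma NLnum_support (mu nu la al be ga : seq nat) :
  is_part al -> is_part be -> is_part ga ->
  LRcoef al be mu * LRcoef al ga nu * LRcoef be ga la != 0 ->
  [/\ al \in parts_upto (sumn mu), be \in parts_upto (sumn mu)
    & ga \in parts_upto (sumn nu)].
Proof.
move=> pal pbe pga; rewrite !mulf_eq0 !negb_or -andbA => /and3P[].
move=> /LRcoef_neq0 smu /LRcoef_neq0 snu _.
by rewrite !mem_parts_upto pal pbe pga smu snu leq_addr !leq_addl.
Qed.

(* Main.v *)
Require Import Defs.
From mathcomp Require Import all_boot all_order all_algebra all_fingroup.
From mathcomp Require Import zify mpoly.
From Stdlib Require Import ClassicalEpsilon FunctionalExtensionality.

Set Implicit Arguments.
Unset Strict Implicit.
Unset Printing Implicit Defensive.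

Import Order.TTheory GRing.Theory Num.Theory.
Local Open Scope ring_scope.

(** Both sides of the equivalence hold: [NLnum la la la] is positive for every
    partition [la] of even size ([NLnum_gt0]), and the size of [scale_part k la]
    is even if that of [la] is.  Littlewood-Richardson coefficients are
    nonnegative, so it suffices to find one partition [al] such that [s_la]
    occurs in the square of [s_al]; the triple with all three partitions equal
    to [al] then contributes a positive term ([LRcoef_square_gt0]).

    Nonnegativity comes from the Littlewood-Richardson rule, proved along the
    lines of Stembridge's argument.  Semistandard tableaux are encoded as
    Gelfand-Tsetlin patterns, in which the Bender-Knuth involutions are
    reflections of the entries of one level in intervals given by the two
    neighbouring levels.  They show that Schur polynomials are symmetric, which
    writes the product of an alternant with a Schur polynomial as a sum of
    alternants over tableaux ([alt_mul_schur]).  In this sum the tableaux whose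
    reading word fails to stay dominant cancel in pairs, through a reflection of
    only a part of a level ([lr_toggle]); this gives [alt_mul_schur_lr].
    Starting from the empty partition it gives the bialternant formula, and
    after division by the Vandermonde alternant the product of two Schur
    polynomials is a sum of Schur polynomials over tableaux ([schur_mul]).
    Alternants are linearly independent and variables can be set to zero, so the
    coefficients are unique and do not depend on the number of variables
    ([LRcoefE]).

    The partition [al] is found column by column.  The conditions on a pattern
    to be counted are linear inequalities in the pattern and the starting
    partition, so that patterns can be added.  A partition of even size is a sum
    of pairs of columns whose heights [a] and [b] have the same parity (a column
    of even height is paired with an empty one), and such a pair occurs in the
    square of the column of height [(a + b) / 2]. *)

(** * Gelfand-Tsetlin patterns *)

Section Patterns.

Local Open Scope nat_scope.

(** The sum of the first [m] values of [f]. *)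
Definition psum (f : nat -> nat) (m : nat) : nat := \sum_(j < m) f j.

Lemma psum0 f : psum f 0 = 0.
Proof. exact: big_ord0. Qed.

Lemma psumS f m : psum f m.+1 = psum f m + f m.
Proof. exact: big_ord_recr. Qed.

Lemma eq_psum f g m : (forall j, j < m -> f j = g j) -> psum f m = psum g m.
Proof. by move=> fg; apply: eq_bigr => j _; apply: fg. Qed.

Lemma psumD f g m : psum (fun j => f j + g j) m = psum f m + psum g m.
Proof. exact: big_split. Qed.

(** Gelfand-Tsetlin patterns with top row [b], in an encoding by levels
    [0, ..., n]: if [T] is a semistandard tableau of shape [b] with entries
    below [n], then [x i j] is the number of entries of row [j] that are
    smaller than [i].  All levels from [n] on are equal to the top row, so that
    a tableau determines its pattern as a function. *)
Definition gt_pattern (n : nat) (b : nat -> nat) (x : nat -> nat -> nat) : Prop :=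
  [/\ forall j, x 0 j = 0,
      forall i j, n <= i -> x i j = b j
    & forall i j, i < n -> (x i j <= x i.+1 j) && (x i.+1 j.+1 <= x i j)].

(** With [x i j] as in [gt_pattern], [lr_cond al x k r] says that [al], plus
    the numbers of letters [k] in the rows above [r] and of letters [k.+1] in
    the rows up to [r], has at [k] a value at least as large as at [k.+1].
    All these conditions together say that the reverse reading word of the
    tableau, started at [al], stays dominant. *)
Definition lr_cond (al : nat -> nat) (x : nat -> nat -> nat) (k r : nat) : bool :=
  al k.+1 + psum (x k.+2) r.+1 + psum (x k) r <=
  al k + psum (x k.+1) r + psum (x k.+1) r.+1.

(** The weight of a pattern: the number of letters [k]. *)
Definition gt_weight (n : nat) (x : nat -> nat -> nat) (k : nat) : nat :=
  psum (x k.+1) n - psum (x k) n.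

(** Level [i] of a pattern is reflected in the rows from [r] on.  The levels
    [i.-1] and [i.+1] confine the entry in row [j] to an interval that does not
    depend on the rest of level [i]; the entry is reflected in this interval,
    whose upper end is replaced by [c] in row [r]. *)
Definition toggle (i r c : nat) (x : nat -> nat -> nat) (i' j : nat) : nat :=
  if (i' != i) || (j < r) then x i' j else
  maxn (x i.+1 j.+1) (x i.-1 j)
  + (if j == r then c else minn (x i.+1 j) (x i.-1 j.-1)) - x i j.

Lemma gt_triangular n b x i j : gt_pattern n b x -> i <= n -> i <= j -> x i j = 0.
Proof.
case=> x0 _ xle; elim: i j => [|i IHi] j ilt; first by move=> _; apply: x0.
by case: j => // j ij; have := xle i j ilt; rewrite (IHi j) //; lia.
Qed.

Lemma gt_row_decr n b x i j j' :
  gt_pattern n b x -> i <= n -> j <= j' -> 0 < i -> x i j' <= x i j.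
Proof.
case: i => // i [_ _ xle] ilt jj' _; rewrite -(subnKC jj').
elim: (j' - j) => [|d IHd]; rewrite ?addn0 // addnS.
by have := xle i (j + d) ilt; have := IHd; lia.
Qed.

Lemma gt_level_incr n b x i i' j :
  gt_pattern n b x -> i <= i' -> i' <= n -> x i j <= x i' j.
Proof.
case=> _ _ xle ii'; rewrite -(subnKC ii').
elim: (i' - i) => [|d IHd]; rewrite ?addn0 // addnS => lt.
by have := xle (i + d) j lt; have := IHd (ltnW lt); lia.
Qed.

Lemma psum_level_incr n b x k m :
  gt_pattern n b x -> k < n -> psum (x k) m <= psum (x k.+1) m.
Proof.
by move=> gx kn; apply: leq_sum => j _; apply: gt_level_incr gx _ _.
Qed.

Section Toggle.

Variables (n : nat) (b : nat -> nat) (x : nat -> nat -> nat) (i r c : nat).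
Hypotheses (gx : gt_pattern n b x) (i0 : 0 < i) (ilt : i < n) (rlt : r < n).
Hypotheses (cx : x i r <= c) (c1 : c <= x i.+1 r).
Hypothesis (c2 : 0 < r -> c <= x i.-1 r.-1).

Let x' := toggle i r c x.

Let bnd j : (maxn (x i.+1 j.+1) (x i.-1 j) <= x i j) &&
  (x i j <= x i.+1 j) && ((0 < j) ==> (x i j <= x i.-1 j.-1)).
Proof.
case: gx i0 ilt => _ _ xle; case: i => // i' _ lti /=.
have := xle i'.+1 j lti; have := xle i' j (ltnW lti).
case: j => [|j] /=; first lia.
by have := xle i' j (ltnW lti); lia.
Qed.

Let x'other i' j : i' != i -> x' i' j = x i' j.
Proof. by rewrite /x' /toggle => ->. Qed.

Let x'low j : j < r -> x' i j = x i j.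
Proof. by rewrite /x' /toggle => ->; rewrite orbT. Qed.

Let x'r : x' i r = maxn (x i.+1 r.+1) (x i.-1 r) + c - x i r.
Proof. by rewrite /x' /toggle !eqxx ltnn. Qed.

Let x'high j : r < j -> x' i j = maxn (x i.+1 j.+1) (x i.-1 j)
  + minn (x i.+1 j) (x i.-1 j.-1) - x i j.
Proof. by move=> rj; rewrite /x' /toggle eqxx ltnNge (ltnW rj) gtn_eqF. Qed.

Let bnd' j : (maxn (x i.+1 j.+1) (x i.-1 j) <= x' i j) &&
  (x' i j <= x i.+1 j) && ((0 < j) ==> (x' i j <= x i.-1 j.-1)).
Proof.
have bj := bnd j; case: (ssrnat.ltngtP j r) => [jr|jr|jr].
- by rewrite x'low.
- by rewrite x'high //; move: bj; case: j jr => //= j jr; lia.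
- rewrite {}jr x'r; have := bnd r; case: r c2 c1 cx => [|r'] /= c2' c1' cx'.
    lia.
  by have := c2' isT; lia.
Qed.

Lemma toggle_gt : gt_pattern n b x'.
Proof.
case: gx => x0 xn xle; split=> [j|i' j ni'|i' j lti'].
- by rewrite x'other // eq_sym -lt0n.
- by rewrite x'other ?xn // gtn_eqF // (leq_trans ilt).
- have [->|ne1] := eqVneq i' i.
    have ne : i.+1 != i by lia.
    by have := bnd' j; have := bnd' j.+1; rewrite !(x'other _ ne) /=; lia.
  have [e|ne2] := eqVneq i'.+1 i; last by rewrite !x'other // xle.
  by rewrite e x'other //; have := bnd' j; have := bnd' j.+1; rewrite -e /=; lia.
Qed.

Lemma toggle_row_bound : x' i r <= c.
Proof. by rewrite x'r; have := bnd r; lia. Qed.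

Lemma toggle_other i' j : i' != i -> x' i' j = x i' j.
Proof. exact: x'other. Qed.

Lemma toggle_below j : j < r -> x' i j = x i j.
Proof. exact: x'low. Qed.

Lemma toggleK i' j : toggle i r c x' i' j = x i' j.
Proof.
rewrite {1}/toggle; have [->|ne] := eqVneq i' i; last by rewrite x'other.
have ne1 : i.+1 != i by lia.
have ne2 : i.-1 != i by lia.
rewrite /= !(x'other _ ne1) !(x'other _ ne2).
have bj := bnd j; case: (ssrnat.ltngtP j r) => [jr|jr|jr].
- by rewrite x'low.
- by rewrite x'high //; move: bj; case: j jr => //= j jr; lia.
- by rewrite jr x'r; move: bj; rewrite jr; lia.
Qed.

(* The lower end of the interval for row j and the upper end for row j.+1 are
   the maximum and the minimum of the same two numbers, so that the sum of the
   interval ends telescopes. *)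
Lemma toggle_psum :
  psum (x i) n + psum (x' i) n + psum (x i.+1) r.+1 + psum (x i.-1) r =
  psum (x i) r + psum (x i) r + c + psum (x i.+1) n + psum (x i.-1) n.
Proof.
have tel d : psum (x i) (r.+1 + d) + psum (x' i) (r.+1 + d)
    + minn (x i.+1 (r.+1 + d)) (x i.-1 (r + d)) + psum (x i.+1) r.+1 + psum (x i.-1) r =
  psum (x i) r + psum (x i) r + c + psum (x i.+1) (r.+1 + d).+1
    + psum (x i.-1) (r.+1 + d).
  elim: d => [|d IHd]; rewrite ?addn0.
    rewrite !psumS x'r (eq_psum x'low); have := bnd r; lia.
  have lt : r < r.+1 + d by lia.
  have := bnd (r.+1 + d); have := x'high lt; move: IHd.
  by rewrite !addnS !addSn !psumS /=; lia.
have x0 : x i.+1 n = 0 by apply: gt_triangular gx _ _.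
by have := tel (n - r.+1); rewrite subnKC // !psumS x0; lia.
Qed.

End Toggle.


Lemma toggle_gt_weight n b x i r c k :
  gt_pattern n b x -> k.+1 != i -> k != i ->
  gt_weight n (toggle i r c x) k = gt_weight n x k.
Proof.
move=> gx ne1 ne2; rewrite /gt_weight; congr (_ - _).
  by apply: eq_psum => j _; apply: toggle_other.
by apply: eq_psum => j _; apply: toggle_other.
Qed.

(** Reflecting a whole level in the unmodified intervals: this exchanges the
    numbers of letters [k] and [k.+1], and makes Schur polynomials symmetric. *)
Definition sym_toggle (k : nat) (x : nat -> nat -> nat) : nat -> nat -> nat :=
  toggle k.+1 0 (x k.+2 0) x.

Section SymToggle.

Variables (n : nat) (b : nat -> nat) (x : nat -> nat -> nat) (k : nat).
Hypotheses (gx : gt_pattern n b x) (kn : k.+1 < n).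

Let x1 : x k.+1 0 <= x k.+2 0.
Proof. exact: gt_level_incr gx _ _. Qed.

Lemma sym_toggle_gt : gt_pattern n b (sym_toggle k x).
Proof. by apply: toggle_gt gx _ _ _ _ _ _ => //; lia. Qed.

Lemma sym_toggleK i j : sym_toggle k (sym_toggle k x) i j = x i j.
Proof.
rewrite {1}/sym_toggle [sym_toggle k x k.+2 0]toggle_other; last by lia.
by apply: toggleK gx _ _ _ _ _ _ _ _ => //; lia.
Qed.

Let psumE : psum (x k.+1) n + psum (sym_toggle k x k.+1) n =
  psum (x k.+2) n + psum (x k) n.
Proof.
have n0 : 0 < n by lia.
have := toggle_psum gx (ltn0Sn k) kn n0 x1 (leqnn _) (fun e => False_ind _ (notF e)).
by rewrite -/(sym_toggle k x) psumS !psum0 /=; lia.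
Qed.

Lemma sym_toggle_weightl : gt_weight n (sym_toggle k x) k = gt_weight n x k.+1.
Proof.
rewrite /gt_weight.
have -> : psum (sym_toggle k x k) n = psum (x k) n.
  by apply: eq_psum => j _; apply: toggle_other; lia.
have := psum_level_incr n gx kn; have := psum_level_incr n gx (ltnW kn).
by have := psumE; lia.
Qed.

Lemma sym_toggle_weightr : gt_weight n (sym_toggle k x) k.+1 = gt_weight n x k.
Proof.
rewrite /gt_weight.
have -> : psum (sym_toggle k x k.+2) n = psum (x k.+2) n.
  by apply: eq_psum => j _; apply: toggle_other; lia.
have := psum_level_incr n gx kn; have := psum_level_incr n gx (ltnW kn).
by have := psumE; lia.
Qed.

Lemma sym_toggle_weight k' : k' != k -> k' != k.+1 ->
  gt_weight n (sym_toggle k x) k' = gt_weight n x k'.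
Proof. by move=> *; apply: (toggle_gt_weight _ _ gx); lia. Qed.

End SymToggle.

(** Reflecting the part of level [k.+1] in the rows from [r] on, when
    [lr_cond al x k r] fails: row [r] is reflected in the interval of the values
    for which it fails. *)
Definition lr_toggle (al : nat -> nat) (k r : nat) (x : nat -> nat -> nat) :
    nat -> nat -> nat :=
  toggle k.+1 r
    ((al k.+1 + psum (x k.+2) r.+1 + psum (x k) r)
     - (al k + psum (x k.+1) r + psum (x k.+1) r)).-1 x.

Section LRToggle.

Variables (n : nat) (b al : nat -> nat) (x : nat -> nat -> nat) (k r : nat).
Hypotheses (gx : gt_pattern n b x) (kn : k.+1 < n) (rn : r < n).
Hypotheses (alk : al k.+1 <= al k) (cprev : 0 < r -> lr_cond al x k r.-1).
Hypothesis (nc : ~~ lr_cond al x k r).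

Let c := ((al k.+1 + psum (x k.+2) r.+1 + psum (x k) r)
     - (al k + psum (x k.+1) r + psum (x k.+1) r)).-1.

Let cE : al k.+1 + psum (x k.+2) r.+1 + psum (x k) r
  = c.+1 + (al k + psum (x k.+1) r + psum (x k.+1) r).
Proof. by move: nc; rewrite /c /lr_cond !psumS; lia. Qed.

Let cx : x k.+1 r <= c.
Proof. by move: nc cE; rewrite /lr_cond !psumS; lia. Qed.

(* The value c.+1 would satisfy the condition at row r.  That the condition
   holds at row r.-1 makes this value at most the upper end of the interval. *)
Let c12 : (c <= x k.+2 r) && ((0 < r) ==> (c <= x k r.-1)).
Proof.
move: cprev cE; case: (posnP r) => [->|r0 /(_ isT)].
  by rewrite psumS !psum0; lia.
rewrite -(prednK r0) /= /lr_cond !psumS.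
have /andP[] : (x k.+1 r.-1 <= x k.+2 r.-1) && (x k.+2 r <= x k.+1 r.-1).
  by case: gx => _ _ /(_ _ r.-1 kn); rewrite prednK.
have : x k r.-1 <= x k.+1 r.-1 by apply: gt_level_incr gx _ _; lia.
by rewrite prednK //; lia.
Qed.

Let c1 : c <= x k.+2 r. Proof. by case/andP: c12. Qed.
Let c2 : 0 < r -> c <= x k r.-1. Proof. by case/andP: c12 => _ /implyP. Qed.

Let x' := lr_toggle al k r x.

Let x'E : x' = toggle k.+1 r c x. Proof. by []. Qed.

Let x'other i : i != k.+1 -> forall m, psum (x' i) m = psum (x i) m.
Proof. by move=> ne m; apply: eq_psum => j _; apply: toggle_other. Qed.

Let x'2 m : psum (x' k.+2) m = psum (x k.+2) m.
Proof. by apply: x'other; lia. Qed.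

Let x'0 m : psum (x' k) m = psum (x k) m.
Proof. by apply: x'other; lia. Qed.

Let x'below m : m <= r -> psum (x' k.+1) m = psum (x k.+1) m.
Proof.
by move=> mr; apply: eq_psum => j jm; apply: toggle_below; lia.
Qed.

Lemma lr_toggle_gt : gt_pattern n b x'.
Proof. exact: (@toggle_gt n). Qed.

Lemma lr_toggleK i j : lr_toggle al k r x' i j = x i j.
Proof.
rewrite {1}/lr_toggle x'2 x'0 x'below //.
exact: (@toggleK n b).
Qed.

Lemma lr_toggle_neg : ~~ lr_cond al x' k r.
Proof.
rewrite /lr_cond x'2 x'0 [psum (x' _) r.+1]psumS x'below //.
have : x' k.+1 r <= c := toggle_row_bound gx (ltn0Sn k) kn rn cx c1 c2.
by have := cE; lia.
Qed.

(** The conditions that come before the one at [k] and [r], with rows ordered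
    from above and letters within a row from the largest, are unaffected. *)
Lemma lr_toggle_cond k' r' : (r' < r) || (r' == r) && (k < k') ->
  lr_cond al x' k' r' = lr_cond al x k' r'.
Proof.
move=> lt; have e i m : (m <= r) || (i != k.+1) -> psum (x' i) m = psum (x i) m.
  by have [->|ne _] := eqVneq i k.+1; [rewrite orbF => /x'below|apply: x'other].
by rewrite /lr_cond !e //; lia.
Qed.

Let psumE : psum (x k.+1) n + psum (x' k.+1) n + al k + 1 =
  psum (x k.+2) n + psum (x k) n + al k.+1.
Proof.
by have := toggle_psum gx (ltn0Sn k) kn rn cx c1 c2; rewrite -x'E /=; have := cE; lia.
Qed.

Lemma lr_toggle_weightl :
  (al k + gt_weight n x' k).+1 = al k.+1 + gt_weight n x k.+1.
Proof.
rewrite /gt_weight x'0.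
have := psum_level_incr n gx kn; have := psum_level_incr n lr_toggle_gt (ltnW kn).
by have := psumE; rewrite x'0; lia.
Qed.

Lemma lr_toggle_weightr :
  al k.+1 + gt_weight n x' k.+1 = (al k + gt_weight n x k).+1.
Proof.
rewrite /gt_weight x'2.
have := psum_level_incr n gx (ltnW kn); have := psum_level_incr n lr_toggle_gt kn.
by have := psumE; rewrite x'2; lia.
Qed.

Lemma lr_toggle_weight k' : k' != k -> k' != k.+1 ->
  gt_weight n x' k' = gt_weight n x k'.
Proof. by move=> *; apply: (toggle_gt_weight _ _ gx); lia. Qed.

End LRToggle.

(** The pattern of the tableau whose row [j] only has letters [j]. *)
Definition top_pattern (b : nat -> nat) (i j : nat) : nat :=
  if j < i then b j else 0.

Lemma psum_top_pattern b i m : psum (top_pattern b i) m = psum b (minn i m).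
Proof.
elim: m => [|m IHm]; first by rewrite minn0 !psum0.
rewrite psumS IHm /top_pattern; case: (ltnP m i) => mi.
  by rewrite (minn_idPr mi) psumS.
by rewrite addn0 (minn_idPl (leqW mi)).
Qed.

Lemma top_pattern_gt n b : {homo b : i j / i <= j >-> j <= i} ->
  (forall j, n <= j -> b j = 0) -> gt_pattern n b (top_pattern b).
Proof.
move=> bdec b0; split=> [j|i j ni|i j ilt]; rewrite /top_pattern //.
  by case: ltnP => // ij; rewrite b0 // (leq_trans ni).
by have := bdec _ _ (leqnSn j); do 3 case: ifP; lia.
Qed.

Lemma top_pattern_weight n b k : k < n -> gt_weight n (top_pattern b) k = b k.
Proof.
by move=> kn; rewrite /gt_weight !psum_top_pattern !(minn_idPl _) ?psumS //; lia.
Qed.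

Lemma top_pattern_cond b k r : {homo b : i j / i <= j >-> j <= i} ->
  lr_cond (fun=> 0) (top_pattern b) k r.
Proof.
move=> bdec; rewrite /lr_cond !psum_top_pattern; have [kr|rk] := boolP (k < r).
  by rewrite !(minn_idPl _) ?psumS; try lia; have := bdec _ _ (leqnSn k); lia.
rewrite [minn k.+1 r](minn_idPr _); last lia.
rewrite [minn k.+1 r.+1](minn_idPr _); last lia.
rewrite [minn k.+2 r.+1](minn_idPr _); last lia.
by rewrite (minn_idPr _); lia.
Qed.

(** Only one tableau is dominant from the start: row [r] can contain no letter
    [k.+1] with [r <= k], because the rows above it contain no letter [k]. *)
Lemma lr_cond0_top_pattern n b x : gt_pattern n b x ->
  (forall k r, k.+1 < n -> r < n -> lr_cond (fun=> 0) x k r) ->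
  forall i j, i <= n -> x i j = top_pattern b i j.
Proof.
move=> gx good; have const r : forall i, r < i -> i < n -> x i.+1 r = x i r.
  elim/ltn_ind: r => r IHr i ri ilt; case: i => // k in ri ilt *.
  have e m : r <= m.+1 -> r < m.+2 -> m.+1 < n -> psum (x m.+2) r = psum (x m.+1) r.
    by move=> *; apply: eq_psum => j jr; apply: IHr; lia.
  have e0 : psum (x k.+1) r = psum (x k) r.
    by apply: eq_psum => j jr; apply: IHr; lia.
  have := good k r ilt (ltn_trans ri ilt); rewrite /lr_cond !psumS e ?e0; try lia.
  by have := gt_level_incr r gx (leqnSn k.+1) ilt; lia.
move=> i j ile; rewrite /top_pattern; case: ltnP => ij; last first.
  exact: gt_triangular gx _ _.
have [_ xn _] := gx; rewrite -(xn n) // -(subnKC ile).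
have : i + (n - i) <= n by lia.
elim: (n - i) => [|d IHd]; first by rewrite addn0.
by move=> lt; rewrite addnS const ?IHd //; lia.
Qed.

(** * A self-product containing every partition of even size *)

(** The indicator sequence of the column of height [m]. *)
Definition column_ind (m j : nat) : nat := j < m.

(** The column of height [m = (a + b) / 2] with letters
    [0, ..., b-1, m, ..., a-1] gives the product of two such columns a term
    with columns of heights [a] and [b]. *)
Definition column_letter (b m j : nat) : nat := if j < b then j else m + (j - b).

Definition column_pattern (b m i j : nat) : nat := (j < m) && (column_letter b m j < i).

Lemma psum_column_pattern b m i r : b <= m ->
  psum (column_pattern b m i) r =
  minn (minn i b) r + (minn (minn r m) (i - m + b) - b).
Proof.
move=> bm; elim: r => [|r IHr]; first by rewrite psum0; lia.
rewrite psumS {}IHr /column_pattern /column_letter.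
by case: (ltnP r b) => ?; lia.
Qed.

Lemma column_pattern_gt n a b m : b <= a -> a <= n -> a + b = m.*2 ->
  gt_pattern n (column_ind m) (column_pattern b m).
Proof.
move=> ba an abm; split=> [j|i j ni|i j ilt];
  rewrite /column_pattern /column_letter /column_ind.
- by rewrite ltn0 andbF.
- by case: ifP; lia.
- by case: ifP; case: ifP; lia.
Qed.

Lemma column_pattern_cond b m k r : b <= m ->
  lr_cond (column_ind m) (column_pattern b m) k r.
Proof.
move=> bm; rewrite /lr_cond !psum_column_pattern // /column_ind.
have [lt|ge] := ltnP k m; last first.
  have -> : minn k b = b by lia.
  have -> : minn k.+1 b = b by lia.
  have -> : minn k.+2 b = b by lia.
  by rewrite !subSn ?(leqW ge) //; lia.
have -> : k - m = 0 by lia.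
have -> : k.+1 - m = 0 by lia.
have [lt1|ge1] := ltnP k.+1 m.
  have -> : k.+2 - m = 0 by lia.
  by rewrite !add0n; lia.
have mk : m = k.+1 by lia.
rewrite mk subSnn; rewrite mk in bm; move: lt; rewrite mk => _.
by lia.
Qed.

Lemma column_pattern_weight n a b m j : b <= a -> a <= n -> a + b = m.*2 -> j < n ->
  column_ind m j + gt_weight n (column_pattern b m) j =
  column_ind a j + column_ind b j.
Proof.
move=> ba an abm jn; have bm : b <= m by lia.
have mn : m <= n by lia.
have e i : psum (column_pattern b m i) n = minn i b + (minn m (i - m + b) - b).
  by rewrite psum_column_pattern // (minn_idPr mn) (minn_idPl _); lia.
rewrite /gt_weight !e /column_ind; have {abm} -> : a = m.*2 - b by lia.
by lia.
Qed.

(** [lr_square n f] says that [f] is the sum of the shape and of the weight of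
    a tableau whose reading word is dominant when started at its own shape [al];
    so [s_f] occurs in the square of [s_al]. *)
Definition lr_square (n : nat) (f : nat -> nat) : Prop :=
  exists al x,
  [/\ {homo al : i j / i <= j >-> j <= i}, forall j, n <= j -> al j = 0,
      gt_pattern n al x, forall k r, lr_cond al x k r
    & forall j, j < n -> f j = al j + gt_weight n x j].

Lemma lr_square0 n : lr_square n (fun=> 0).
Proof.
exists (fun=> 0), (fun _ _ => 0); split=> //.
  by move=> k r; rewrite /lr_cond /psum !big1.
by move=> j _; rewrite /gt_weight /psum !big1.
Qed.

(** The defining inequalities are linear, so they are closed under sums. *)
Lemma lr_squareD n f g : lr_square n f -> lr_square n g ->
  lr_square n (fun j => f j + g j).
Proof.
move=> [al [x [aldec al0 gx cx fE]]] [be [y [bedec be0 gy cy gE]]].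
exists (fun j => al j + be j), (fun i j => x i j + y i j); split.
- by move=> i j ij; rewrite leq_add ?aldec ?bedec.
- by move=> j nj; rewrite al0 ?be0.
- case: gx gy => x0 xn xle [y0 yn yle]; split=> [j|i j ni|i j ilt].
  + by rewrite x0 y0.
  + by rewrite xn ?yn.
  + by have := xle i j ilt; have := yle i j ilt; lia.
- by move=> k r; have := cx k r; have := cy k r; rewrite /lr_cond !psumD; lia.
- move=> j jn; rewrite fE // gE // /gt_weight !psumD.
  by have := psum_level_incr n gx jn; have := psum_level_incr n gy jn; lia.
Qed.

Lemma eq_lr_square n f g : (forall j, j < n -> f j = g j) ->
  lr_square n f -> lr_square n g.
Proof.
move=> fg [al [x [? ? ? ? fE]]]; exists al, x; split=> // j jn.
by rewrite -fg // fE.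
Qed.

Lemma lr_square_col2 n a b : a <= n -> b <= n -> ~~ odd (a + b) ->
  lr_square n (fun j => (j < a) + (j < b)).
Proof.
wlog ba : a b / b <= a => [hw an bn ev|an _ ev].
  have [/hw|ab] := leqP b a; first exact.
  apply: eq_lr_square (hw b a (ltnW ab) bn an _) => [j _|]; first exact: addnC.
  by rewrite addnC.
have abm : a + b = (a + b)./2.*2 by rewrite even_halfK.
exists (column_ind (a + b)./2), (column_pattern b (a + b)./2); split.
- by move=> i j ij; rewrite /column_ind; lia.
- by move=> j nj; rewrite /column_ind; lia.
- exact: column_pattern_gt ba an abm.
- by move=> k r; apply: column_pattern_cond; lia.
- by move=> j jn; rewrite (column_pattern_weight ba an abm jn).
Qed.

(** A partition of even size, given by its column heights: the columns of odd
    height come in pairs. *)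
Lemma lr_square_cols n (s : seq nat) : all (fun a => a <= n) s ->
  ~~ odd (sumn s) -> lr_square n (fun j => \sum_(a <- s) (j < a)).
Proof.
have [m] := ubnP (size s); elim: m s => // m IHm [|a s].
  by move=> *; apply: eq_lr_square (lr_square0 n) => j _; rewrite big_nil.
rewrite ltnS /= => sm /andP[an alls]; have [oa|ea] := boolP (odd a); last first.
  rewrite oddD (negbTE ea) /= => os.
  have a0 : ~~ odd (a + 0) by rewrite addn0.
  apply: eq_lr_square (lr_squareD (lr_square_col2 an (leq0n n) a0) (IHm s sm alls os)).
  by move=> j jn; rewrite big_cons ltn0 addn0.
rewrite oddD oa /= negbK => os.
have /hasP[b bs ob] : has odd s.
  apply: contraLR os; rewrite -all_predC => /allP alle.
  elim: s alle {sm alls} => //= c s IHs alle; rewrite oddD.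
  rewrite (negbTE (alle c (mem_head c s))); apply: IHs => d ds.
  by apply: alle; rewrite in_cons ds orbT.
have ps := perm_to_rem bs.
have bn : b <= n by have /allP := alls; apply.
have ab : ~~ odd (a + b) by rewrite oddD oa ob.
have rn : all (fun c => c <= n) (rem b s).
  by apply/allP => c /mem_rem cs; have /allP := alls; apply.
have ro : ~~ odd (sumn (rem b s)).
  by move: os; rewrite (perm_sumn ps) /= oddD ob; case: odd.
have sz : size (rem b s) < m.
  by rewrite size_rem //; apply: leq_ltn_trans (leq_pred _) sm.
apply: eq_lr_square (lr_squareD (lr_square_col2 an bn ab) (IHm _ sz rn ro)).
by move=> j jn; rewrite [RHS]big_cons (perm_big _ ps) big_cons addnA.
Qed.

End Patterns.

(** * Tableaux and patterns *)

Section Tableaux.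

Local Open Scope nat_scope.

(** A downward closed predicate on [0, ..., n-1] holds exactly below the number
    of its elements. *)
Lemma sum_down_closed (n : nat) (p : nat -> bool) :
  (forall i j, i <= j -> j < n -> p j -> p i) ->
  exists2 m, m = \sum_(i < n) p i & (m <= n) /\ forall i, i < n -> p i = (i < m).
Proof.
elim: n => [|n IHn] pdown; first by exists 0; rewrite ?big_ord0.
have [|m mE [mn pm]] := IHn; first by move=> i j ij jn; apply: pdown ij (leqW jn).
rewrite big_ord_recr /= -mE; have [pn|npn] := boolP (p n); last first.
  exists m; rewrite ?addn0 //; split=> [|i]; first exact: leqW.
  by rewrite ltnS leq_eqVlt => /predU1P[->|/pm//]; rewrite (negbTE npn) ltnNge mn.
have {mE} -> : m = n.
  apply/eqP; rewrite eqn_leq mn leqNgt; apply/negP => lt.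
  by have := pm m lt; rewrite ltnn (pdown _ n).
exists n.+1; rewrite ?addn1 //; split=> // i lt.
by rewrite lt; apply: pdown pn.
Qed.

Lemma lt_sum_down_closed (n : nat) (p : nat -> bool) (i : nat) :
  (forall i j, i <= j -> j < n -> p j -> p i) -> i < n ->
  (i < \sum_(j < n) p j) = p i.
Proof. by move=> /sum_down_closed[m <- [_ pm]] /pm->. Qed.

Lemma part_decr (la : seq nat) :
  is_part la -> {homo nth 0 la : i j / i <= j >-> j <= i}.
Proof.
move=> /andP[sla _] i j; case: (ltnP j (size la)) => [jl ij|jl _].
  by apply: (sorted_leq_nth (rev_trans leq_trans) leqnn) => //; exact: leq_ltn_trans jl.
by rewrite nth_default.
Qed.

Lemma part_nth_gt0 (la : seq nat) i :
  is_part la -> (0 < nth 0 la i) = (i < size la).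
Proof.
move=> /andP[_ nla]; case: (ltnP i (size la)) => il; last by rewrite nth_default.
by rewrite lt0n; apply: contraNneq nla => <-; apply: mem_nth.
Qed.

Lemma part_eq (la mu : seq nat) : is_part la -> is_part mu ->
  (forall i, nth 0 la i = nth 0 mu i) -> la = mu.
Proof.
move=> pla pmu e; apply: (eq_from_nth (x0 := 0)) => [|i _]; last exact: e.
have lt i : (i < size la) = (i < size mu).
  by rewrite -(part_nth_gt0 _ pla) -(part_nth_gt0 _ pmu) e.
by apply/eqP; rewrite eqn_leq leqNgt lt ltnn /= leqNgt -lt ltnn.
Qed.

Lemma size_part_le (la : seq nat) : is_part la -> size la <= sumn la.
Proof.
case/andP=> _; elim: la => //= x la IHla; rewrite in_cons negb_or eq_sym -lt0n.
by move=> /andP[x0 /IHla]; lia.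
Qed.

Section Cells.

Variable be : seq nat.

Lemma cell_colP (c : cell be) : cell_col c < nth 0 be (cell_row c).
Proof. exact: ltn_ord. Qed.

Lemma cell_rowP (c : cell be) : cell_row c < size be.
Proof. exact: ltn_ord. Qed.

Lemma cell_inj (c d : cell be) :
  cell_row c = cell_row d -> cell_col c = cell_col d -> c = d.
Proof.
case: c d => [i j] [i' j']; rewrite /cell_row /cell_col /= => /val_inj ii'.
by case: i' / ii' j' => j' /val_inj ->.
Qed.

Lemma cell_of (r c : nat) : c < nth 0 be r ->
  {x : cell be | cell_row x = r & cell_col x = c}.
Proof.
move=> cr; have rs : r < size be.
  by rewrite ltnNge; apply/negP => /(nth_default 0) e; rewrite e in cr.
by exists (Tagged (fun i : 'I_(size be) => 'I_(nth 0 be i))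
             (Ordinal cr : 'I_(nth 0 be (Ordinal rs)))).
Qed.

Lemma sum_cell_row (r m : nat) :
  \sum_(x : cell be | cell_row x == r) (cell_col x < m) = minn m (nth 0 be r).
Proof.
have cnt b : \sum_(j < b) (j < m) = minn m b.
  by elim: b => [|b IHb]; rewrite ?big_ord0 ?big_ord_recr /= ?IHb; lia.
pose P := fun i : 'I_(size be) => val i == r.
transitivity (\sum_(i < size be | P i) \sum_(j < nth 0 be i) (j < m)).
  rewrite (sig_big_dep P (fun i (j : 'I_(nth 0 be i)) => true)
             (fun i (j : 'I_(nth 0 be i)) => (j < m) : nat)).
  by apply: eq_bigl => x; rewrite andbT.
case: (ltnP r (size be)) => rs; last first.
  rewrite big1 ?nth_default ?minn0 // => i /eqP ir.
  by have := ltn_ord i; rewrite [nat_of_ord i]ir ltnNge rs.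
by rewrite (big_pred1 (Ordinal rs)) ?cnt // => i; rewrite -val_eqE.
Qed.

Variable n : nat.
Implicit Type T : {ffun cell be -> 'I_n}.

Lemma semistandard_row T c d : semistandard T ->
  cell_row c = cell_row d -> cell_col c <= cell_col d -> T c <= T d.
Proof.
move=> /forallP/(_ c)/forallP/(_ d)/andP[/implyP sT _] e.
rewrite leq_eqVlt => /predU1P[e'|lt]; first by rewrite (cell_inj e e').
by apply: sT; rewrite e eqxx.
Qed.

Lemma semistandard_col T c d : semistandard T ->
  cell_col c = cell_col d -> cell_row c < cell_row d -> T c < T d.
Proof.
move=> /forallP/(_ c)/forallP/(_ d)/andP[_ /implyP sT] e lt.
by apply: sT; rewrite e eqxx.
Qed.

(** The pattern of a tableau: [pat T i j] is the number of entries of row [j]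
    smaller than [i]. *)
Definition pat T (i j : nat) : nat := \sum_(x : cell be | cell_row x == j) (T x < i).

(** The tableau of a pattern; the entry in column [c] of row [j] is the number
    of levels [i.+1] with [x i.+1 j <= c].  The tableau [T0] only serves to
    supply default values. *)
Definition tab (T0 : {ffun cell be -> 'I_n}) (x : nat -> nat -> nat) :
    {ffun cell be -> 'I_n} :=
  [ffun c => insubd (T0 c) (\sum_(i < n) (x i.+1 (cell_row c) <= cell_col c))].

Lemma lt_pat T i c : semistandard T ->
  (cell_col c < pat T i (cell_row c)) = (T c < i).
Proof.
move=> sT; rewrite /pat; have [lt|ge] := ltnP (T c) i.
  have := sum_cell_row (cell_row c) (cell_col c).+1.
  have /minn_idPl -> := cell_colP c => {1}<-.
  apply: leq_sum => d /eqP dc; rewrite ltnS; case: (leqP (cell_col d)) => //= le.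
  by rewrite (leq_ltn_trans (semistandard_row sT dc le)).
apply/negbTE; rewrite -leqNgt.
have := sum_cell_row (cell_row c) (cell_col c).
have /ltnW/minn_idPl -> := cell_colP c => <-.
apply: leq_sum => d /eqP dc; case: (ltnP (cell_col d)) => //= [_|le].
  exact: leq_b1.
by rewrite ltnNge (leq_trans ge) // (semistandard_row sT).
Qed.

Lemma pat_le T i j : pat T i j <= nth 0 be j.
Proof.
have := sum_cell_row j (nth 0 be j); rewrite minnn => <-.
apply: leq_sum => x /eqP xj; apply: leq_trans (leq_b1 _) _.
by rewrite -xj cell_colP.
Qed.

Hypothesis (pbe : is_part be).

Lemma pat_gt T : semistandard T -> gt_pattern n (nth 0 be) (pat T).
Proof.
move=> sT; split=> [j|i j ni|i j _].
- by rewrite /pat big1.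
- have := sum_cell_row j (nth 0 be j); rewrite minnn => <-.
  apply: eq_bigr => x /eqP xj.
  by rewrite (leq_trans (ltn_ord _)) // -xj cell_colP.
- apply/andP; split.
    by apply: leq_sum => x _; case: (ltnP _ i) => // /ltnW; rewrite -ltnS => ->.
  case p: (pat T i.+1 j.+1) => [//|m].
  have mj1 : m < nth 0 be j.+1 by rewrite -p pat_le.
  have mj := leq_trans mj1 (part_decr pbe (leqnSn j)).
  have [y yr yc] := cell_of mj1; have [z zr zc] := cell_of mj.
  have := lt_pat i.+1 y sT; rewrite yr yc p ltnSn => /esym lty.
  have zy : T z < T y by apply: semistandard_col; rewrite ?yr ?zr ?yc ?zc.
  by rewrite -{1}zc -zr lt_pat // (leq_trans zy).
Qed.

Section Tab.

Variables (T0 : {ffun cell be -> 'I_n}) (x : nat -> nat -> nat).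
Hypothesis gx : gt_pattern n (nth 0 be) x.

Lemma tab_lt c i : (tab T0 x c < i) = (cell_col c < x i (cell_row c)).
Proof.
have [x0 xn _] := gx.
have [m mE [mn mP]] : exists2 m,
    m = \sum_(i < n) (x i.+1 (cell_row c) <= cell_col c) &
    (m <= n) /\ forall i, i < n -> (x i.+1 (cell_row c) <= cell_col c) = (i < m).
  apply: sum_down_closed => j k jk kn; apply: leq_trans.
  exact: gt_level_incr gx _ _.
have lt : m < n.
  rewrite ltnNge; apply/negP => nm.
  have n0 : 0 < n by apply: leq_ltn_trans (ltn_ord (T0 c)).
  have := mP n.-1; rewrite prednK // => /(_ (leqnn n)); rewrite xn //.
  by rewrite leqNgt cell_colP (leq_trans _ nm) // prednK.
rewrite ffunE -mE val_insubd lt.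
case: i => [|i]; first by rewrite x0.
rewrite ltnS; case: (ltnP i n) => ilt; first by rewrite ltnNge mP // -leqNgt.
by rewrite xn ?(leqW ilt) // cell_colP (leq_trans mn).
Qed.

Lemma tab_semistandard : semistandard (tab T0 x).
Proof.
apply/forallP => c; apply/forallP => d.
apply/andP; split; apply/implyP => /andP[/eqP e lt].
  by rewrite -ltnS tab_lt e (ltn_trans lt) // -tab_lt.
rewrite tab_lt e; have := tab_lt d (tab T0 x d).+1; rewrite ltnSn => /esym h.
apply: leq_trans h _; have [_ _ xle] := gx; set v := nat_of_ord _.
have vn : v < n := ltn_ord _; rewrite -[cell_row d](subnKC lt) addSn.
have /andP[_ h] := xle v (cell_row c + (cell_row d - (cell_row c).+1)) vn.
apply: leq_trans h _.
have [v0|v0] := posnP v; first by rewrite v0; have [-> _ _] := gx.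
exact: gt_row_decr gx (ltnW vn) (leq_addr _ _) v0.
Qed.

Lemma pat_tab : pat (tab T0 x) = x.
Proof.
have [x0 xn _] := gx.
apply: functional_extensionality => i; apply: functional_extensionality => j.
transitivity (\sum_(y : cell be | cell_row y == j) (cell_col y < x i j)).
  by apply: eq_bigr => y /eqP yj; rewrite tab_lt yj.
rewrite sum_cell_row; apply/minn_idPl.
have [le|/ltnW le] := leqP i n; last by rewrite xn.
by rewrite -(xn n) //; apply: gt_level_incr gx _ _.
Qed.

End Tab.

Lemma tab_pat T0 T : semistandard T -> tab T0 (pat T) = T.
Proof.
move=> sT; apply/ffunP => c; apply/val_inj/eqP; rewrite eqn_leq /=.
have e i : (tab T0 (pat T) c < i) = (T c < i).
  by rewrite tab_lt ?lt_pat //; apply: pat_gt.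
by rewrite -ltnS e ltnSn -ltnS -e ltnSn.
Qed.

(** Every involution of the set of patterns satisfying [P] can be used to
    rewrite a sum over the corresponding tableaux. *)
Lemma big_pattern_inv (V : nmodType) (P : pred (nat -> nat -> nat))
    (h : (nat -> nat -> nat) -> (nat -> nat -> nat))
    (F G : (nat -> nat -> nat) -> V) :
  (forall x, gt_pattern n (nth 0 be) x -> P x ->
    [/\ gt_pattern n (nth 0 be) (h x), P (h x), h (h x) = x & F (h x) = G x]) ->
  (\sum_(T | semistandard T && P (pat T)) F (pat T) =
   \sum_(T | semistandard T && P (pat T)) G (pat T))%R.
Proof.
move=> hP; pose hT T := tab T (h (pat T)).
have hTP T : semistandard T && P (pat T) ->
    [/\ semistandard (hT T), pat (hT T) = h (pat T) & P (pat (hT T))].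
  move=> /andP[sT PT]; have [gh Ph _ _] := hP _ (pat_gt sT) PT.
  by rewrite /hT tab_semistandard // pat_tab.
have hTK T : semistandard T && P (pat T) -> hT (hT T) = T.
  move=> PT; have /andP[sT PpT] := PT; have [_ pT _] := hTP T PT.
  rewrite {1}/hT pT; have [_ _ -> _] := hP _ (pat_gt sT) PpT.
  exact: tab_pat.
rewrite (reindex_onto hT hT) //; apply: eq_big => [T|T /andP[/andP[sT PT] /eqP hT2]].
  apply/andP/idP => [[PT /eqP e]|PT]; last first.
    by rewrite hTK // eqxx; have [-> _ ->] := hTP _ PT.
  by rewrite -e; have [-> _ ->] := hTP _ PT.
have PT' : semistandard (hT T) && P (pat (hT T)) by rewrite sT.
have [sT' _ PT2] := hTP _ PT'; rewrite hT2 in sT' PT2.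
have PTT : semistandard T && P (pat T) by rewrite sT'.
have [_ -> _] := hTP _ PTT.
by have [_ _ _ ->] := hP _ (pat_gt sT') PT2.
Qed.

Lemma big_pattern_invT (V : nmodType)
    (h : (nat -> nat -> nat) -> (nat -> nat -> nat))
    (F G : (nat -> nat -> nat) -> V) :
  (forall x, gt_pattern n (nth 0 be) x ->
    [/\ gt_pattern n (nth 0 be) (h x), h (h x) = x & F (h x) = G x]) ->
  (\sum_(T | semistandard T) F (pat T) = \sum_(T | semistandard T) G (pat T))%R.
Proof.
move=> hP; have e : (fun T => semistandard T && true) =1 @semistandard n be.
  by move=> T; rewrite andbT.
rewrite -!(eq_bigl _ _ e); apply: (big_pattern_inv (P := xpredT) (h := h)) => x gx _.
by have [] := hP x gx.
Qed.

Hypothesis (sbe : size be <= n).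

Lemma psum_pat T i : psum (pat T i) n = \sum_(x : cell be) (T x < i).
Proof.
pose row (x : cell be) : 'I_n := Ordinal (leq_trans (cell_rowP x) sbe).
by rewrite /psum /pat (partition_big row xpredT).
Qed.

Lemma gt_weight_pat T (k : nat) :
  gt_weight n (pat T) k = \sum_(x : cell be) (T x == k :> nat).
Proof.
rewrite /gt_weight !psum_pat; apply/eqP.
rewrite -(eqn_add2r (\sum_(x : cell be) (T x < k))) subnK.
  rewrite -big_split /=; apply/eqP/eq_bigr => x _.
  by rewrite ltnS leq_eqVlt; case: ltngtP.
by apply: leq_sum => x _; case: (ltnP _ k) => // /ltnW; rewrite -ltnS => ->.
Qed.

End Cells.

End Tableaux.

(** * Schur polynomials and alternants *)

Lemma symmetric_adjacent (n : nat) (p : {mpoly int[n]}) :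
  (forall i j : 'I_n, j = i.+1 :> nat -> msym (tperm i j) p = p) ->
  forall s, msym s p = p.
Proof.
move=> adj; have far d (i j : 'I_n) : (i + d)%N = j -> msym (tperm i j) p = p.
  elim: d j => [|d IHd] j ij.
    have -> : i = j by apply: val_inj; rewrite /= -ij addn0.
    by rewrite tperm1 msym1m.
  have [d0|d0] := posnP d; first by apply: adj; rewrite -ij d0 addn1.
  have lt : (i + d < n)%N by rewrite (leq_trans _ (ltn_ord j)) // -ij addnS.
  pose k := Ordinal lt; have kj : j = k.+1 :> nat by rewrite -ij addnS.
  have ne (a b : 'I_n) : (a < b)%N -> b != a by move=> ab; rewrite -val_eqE gtn_eqF.
  have -> : tperm i j = (tperm i k ^ tperm k j)%g.
    by rewrite tpermJ tpermL tpermD // ne //= -?ij; lia.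
  by rewrite conjgE tpermV !msymMm adj // IHd // adj.
move=> s; have [ts -> _] := prod_tpermP s.
elim: ts => [|[i j] ts IHts]; first by rewrite big_nil msym1m.
rewrite big_cons msymMm /=; have -> : msym (tperm i j) p = p => //.
have [ij|/ltnW ji] := leqP i j; first by apply: (far (j - i)%N); rewrite subnKC.
by rewrite tpermC; apply: (far (i - j)%N); rewrite subnKC.
Qed.

(** The alternant [\det (x_i ^ ga_j)] with exponents [ga 0, ..., ga n.-1]. *)
Definition alt (n : nat) (ga : nat -> nat) : {mpoly int[n]} :=
  \det (\matrix_(i < n, j < n) 'X_i ^+ ga j).

Lemma altE n ga :
  alt n ga = \sum_(s : 'S_n) (-1) ^+ s * 'X_[ [multinom ga (s i) | i < n] ].
Proof.
apply: eq_bigr => s _; congr (_ * _); rewrite mpolyXE_id.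
by apply: eq_bigr => i _; rewrite mxE mnmE.
Qed.

Lemma eq_alt n ga de : (forall j, (j < n)%N -> ga j = de j) -> alt n ga = alt n de.
Proof.
by move=> e; rewrite /alt; congr (\det _); apply/matrixP => i j; rewrite !mxE e.
Qed.

Lemma alt_swap n ga de k : (k.+1 < n)%N -> de k = ga k.+1 -> de k.+1 = ga k ->
  (forall j, j != k -> j != k.+1 -> de j = ga j) -> alt n de = - alt n ga.
Proof.
move=> kn e1 e2 e3; pose a := Ordinal (ltnW kn); pose b := Ordinal kn.
have ab : a != b by rewrite -val_eqE /= ltn_eqF.
pose M : 'M[{mpoly int[n]}]_n := \matrix_(i < n, j < n) 'X_i ^+ ga j.
have -> : alt n de = \det (xcol a b M).
  rewrite /alt; congr (\det _); apply/matrixP => i j; rewrite !mxE.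
  case: tpermP => [->|->|/eqP ja /eqP jb] //=; first by rewrite e1.
    by rewrite e2.
  by rewrite e3.
by rewrite xcolE det_mulmx det_perm odd_tperm ab expr1 mulrN1.
Qed.

(** Alternants with strictly decreasing exponents have distinct leading
    monomials, so they are linearly independent. *)
Lemma alt_coef n ga de :
  {in [pred j | (j < n)%N] &, {homo ga : i j / (i < j)%N >-> (j < i)%N}} ->
  {in [pred j | (j < n)%N] &, {homo de : i j / (i < j)%N >-> (j < i)%N}} ->
  (alt n ga)@_([multinom de i | i < n]) = [forall i : 'I_n, ga i == de i]%:R.
Proof.
move=> gdec ddec.
(* Only the identity permutation is increasing. *)
have perm1P (s : 'S_n) : {homo s : i j / (i < j)%N} -> s = 1%g.
  move=> sinc.
  have le (t : 'S_n) (i : 'I_n) : {homo t : i j / (i < j)%N} -> (i <= t i)%N.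
    move=> tinc; case: i => i lti; elim: i lti => // i IHi lti.
    by apply: leq_ltn_trans (IHi (ltnW lti)) _; apply: tinc.
  apply/permP => i; rewrite perm1; apply/val_inj/eqP; rewrite eqn_leq /= le // andbT.
  rewrite -{2}(permK s i) le // => {}i j ij.
  rewrite ltnNge leq_eqVlt; apply/norP; split.
    by apply: contraTneq ij => /val_inj/perm_inj->; rewrite ltnn.
  by apply/negP => /sinc; rewrite !permKV ltnNge (ltnW ij).
rewrite altE raddf_sum /=.
have e s : ((-1) ^+ odd_perm s * 'X_[[multinom ga (s i) | i < n]]
              : {mpoly int[n]})@_([multinom de i | i < n])
    = (-1) ^+ odd_perm s * ([forall i : 'I_n, ga (s i) == de i]%:R : int).
  rewrite -[X in X * 'X_[_]](_ : ((-1) ^+ odd_perm s)%:MP = _); last first.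
    exact: rmorph_sign.
  rewrite mcoeffCM mcoeffX; congr (_ * (nat_of_bool _)%:R).
  apply/eqP/forallP => [/mnmP h i|h]; first by have := h i; rewrite !mnmE => ->.
  by apply/mnmP => i; rewrite !mnmE; apply/eqP.
under eq_bigr do rewrite e.
rewrite (bigD1 1%g) //= odd_perm1 mul1r big1 ?addr0.
  by congr ((nat_of_bool _)%:R); apply: eq_forallb => i; rewrite perm1.
move=> s; apply: contraNeq; rewrite mulf_eq0 negb_or => /andP[_].
rewrite pnatr_eq0 eqb0 negbK => /forallP h.
apply/eqP; apply: (perm1P s) => i j ij; rewrite ltnNge leq_eqVlt; apply/norP; split.
  by apply: contraTneq ij => /val_inj/perm_inj->; rewrite ltnn.
apply/negP => lt; have := gdec _ _ (ltn_ord (s j)) (ltn_ord (s i)) lt.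
by rewrite (eqP (h i)) (eqP (h j)) ltnNge (ltnW (ddec _ _ _ _ ij)) //; exact: ltn_ord.
Qed.

Section Schur.

Variables (n : nat) (be : seq nat).
Hypotheses (pbe : is_part be) (sbe : (size be <= n)%N).

Lemma schur_pat : schur n be = \sum_(T : {ffun cell be -> 'I_n} | semistandard T)
  'X_[ [multinom gt_weight n (pat T) i | i < n] ].
Proof.
apply: eq_bigr => T _; rewrite mprodXE; congr 'X_[_]; apply/mnmP => i.
rewrite mnmE mnm_sumE gt_weight_pat //.
by apply: eq_bigr => x _; rewrite mnm1E -val_eqE.
Qed.

Lemma schur_sym s : msym s (schur n be) = schur n be.
Proof.
apply: symmetric_adjacent => {}s j js; rewrite schur_pat raddf_sum /=.
have kn : (s.+1 < n)%N by rewrite -js.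
pose F x : {mpoly int[n]} := 'X_[ [multinom gt_weight n x (tperm s j i) | i < n] ].
pose G x : {mpoly int[n]} := 'X_[ [multinom gt_weight n x i | i < n] ].
transitivity (\sum_(T : {ffun cell be -> 'I_n} | semistandard T) F (pat T)).
  apply: eq_bigr => T _; rewrite msymX tpermV; congr 'X_[_].
  by apply/mnmP => i; rewrite !mnmE.
apply: (@big_pattern_invT be n pbe _ (sym_toggle s) F G) => x gx.
split=> //; first exact: sym_toggle_gt.
  apply: functional_extensionality => i; apply: functional_extensionality => m.
  exact: sym_toggleK gx kn i m.
rewrite /F /G; congr 'X_[_]; apply/mnmP => i; rewrite !mnmE.
case: tpermP => [->|->|/eqP ia /eqP ib].
- by rewrite js (sym_toggle_weightr gx kn).
- by rewrite js (sym_toggle_weightl gx kn).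
- by rewrite (sym_toggle_weight gx) // -?js.
Qed.

(** A symmetric polynomial can be multiplied into an alternant term by term,
    permuting its monomials along with those of the alternant. *)
Lemma alt_mul_schur ga : alt n ga * schur n be =
  \sum_(T : {ffun cell be -> 'I_n} | semistandard T)
    alt n (fun j => (ga j + gt_weight n (pat T) j)%N).
Proof.
rewrite altE mulr_suml.
under [RHS]eq_bigr do rewrite altE.
rewrite exchange_big /=; apply: eq_bigr => s _.
rewrite -mulrA -mulr_sumr; congr (_ * _).
rewrite -(schur_sym s^-1) schur_pat raddf_sum mulr_sumr /=; apply: eq_bigr => T _.
rewrite msymX invgK -mpolyXD; congr 'X_[_]; apply/mnmP => i.
by rewrite mnmDE !mnmE.
Qed.

End Schur.

(** * The Littlewood-Richardson rule *)

(** The pattern satisfies all the conditions [lr_cond]; its tableau is then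
    counted by the Littlewood-Richardson rule. *)
Definition lr_dominant (n : nat) (al : nat -> nat) (x : nat -> nat -> nat) : bool :=
  [forall r : 'I_n, forall k : 'I_n, (k.+1 < n)%N ==> lr_cond al x k r].

Section LRRule.

Variables (n : nat) (be : seq nat) (al : nat -> nat).
Hypotheses (pbe : is_part be) (sbe : (size be <= n)%N).
Hypothesis (aldec : {homo al : i j / (i <= j)%N >-> (j <= i)%N}).

(* The conditions in the rows above r, and those in row r for letters at
   least k. *)
Let dominant_upto (r k : nat) (x : nat -> nat -> nat) : bool :=
  [forall r' : 'I_n, forall k' : 'I_n,
    (k'.+1 < n)%N && ((r' < r)%N || (r' == r :> nat) && (k <= k')%N)
    ==> lr_cond al x k' r'].

Let dominant_uptoP r k x :
  reflect (forall r' k', (r' < n)%N -> (k'.+1 < n)%N ->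
            (r' < r)%N || (r' == r) && (k <= k')%N -> lr_cond al x k' r')
          (dominant_upto r k x).
Proof.
apply: (iffP forallP) => [h r' k' rn kn c|h r'].
  have /forallP/(_ (Ordinal (ltnW kn)))/implyP := h (Ordinal rn).
  by rewrite /= kn c; apply.
by apply/forallP => k'; apply/implyP => /andP[kn c]; apply: h.
Qed.

Let term (x : nat -> nat -> nat) : {mpoly int[n]} :=
  alt n (fun j => (al j + gt_weight n x j + (n.-1 - j))%N).

Local Notation tableau_sum P :=
  (\sum_(T : {ffun cell be -> 'I_n} | semistandard T && P (pat T)) term (pat T)).

Let lr_toggle_term x k r : gt_pattern n (nth 0%N be) x -> (k.+1 < n)%N -> (r < n)%N ->
  ((0 < r)%N -> lr_cond al x k r.-1) -> ~~ lr_cond al x k r ->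
  term (lr_toggle al k r x) = - term x.
Proof.
move=> gx kn rn cprev nc; have alk := aldec (leqnSn k).
have wl := lr_toggle_weightl gx kn rn alk cprev nc.
have wr := lr_toggle_weightr gx kn rn alk cprev nc.
apply: (alt_swap kn); first by move: wl; lia.
  by move: wr; lia.
by move=> j j1 j2; rewrite (lr_toggle_weight gx kn rn alk cprev nc j1 j2).
Qed.

(* The tableaux for which the condition at k and r is the first one to fail
   cancel in pairs. *)
Let cancel_step r k : (k.+1 < n)%N -> (r < n)%N ->
  tableau_sum (dominant_upto r k.+1) =
  tableau_sum (dominant_upto r k).
Proof.
move=> kn rn.
pose bad x := dominant_upto r k.+1 x && ~~ lr_cond al x k r.
have zero : tableau_sum bad = 0.
  set S := LHS; suff /eqP : S = - S.
    rewrite -addr_eq0 -mulr2n => /eqP S0; apply/mpolyP => m.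
    by move/mpolyP/(_ m)/eqP: S0; rewrite mcoeffMn mcoeff0 mulrn_eq0 => /eqP.
  rewrite -sumrN; apply: (@big_pattern_inv be n pbe _ bad
    (lr_toggle al k r) term (fun x => - term x)).
  move=> x gx /andP[/dominant_uptoP dx nc].
  have alk := aldec (leqnSn k).
  have cprev : (0 < r)%N -> lr_cond al x k r.-1.
    by move=> r0; apply: dx => //; lia.
  split.
  - exact: lr_toggle_gt.
  - rewrite /bad (lr_toggle_neg gx) // andbT; apply/dominant_uptoP => r' k' rn' kn' c.
    by rewrite (lr_toggle_cond gx kn rn alk cprev nc c); apply: dx.
  - apply: functional_extensionality => i; apply: functional_extensionality => j.
    exact: (lr_toggleK gx).
  - exact: lr_toggle_term.
rewrite (bigID (fun T : {ffun cell be -> 'I_n} => lr_cond al (pat T) k r)) /= addrC.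
rewrite (eq_bigl (fun T => semistandard T && bad (pat T))); last first.
  by move=> T; rewrite /bad andbA.
rewrite zero add0r; apply: eq_bigl => T; rewrite -andbA; congr (_ && _).
apply/andP/dominant_uptoP => [[/dominant_uptoP d c] r' k' rn' kn' h|d].
  have [/andP[/eqP-> /eqP->] //|ne] := boolP ((r' == r) && (k' == k)).
  by apply: d => //; move: h ne; lia.
split; last by apply: d => //; rewrite eqxx leqnn orbT.
by apply/dominant_uptoP => r' k' rn' kn' h; apply: d => //; move: h; lia.
Qed.

(** Stembridge's cancellation argument. *)
Theorem alt_mul_schur_lr :
  alt n (fun j => (al j + (n.-1 - j))%N) * schur n be =
  \sum_(T : {ffun cell be -> 'I_n} | semistandard T && lr_dominant n al (pat T))
    alt n (fun j => (al j + gt_weight n (pat T) j + (n.-1 - j))%N).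
Proof.
rewrite alt_mul_schur //.
transitivity (tableau_sum (dominant_upto 0 n)).
  apply: eq_big => T; last by move=> _; apply: eq_alt => j _; rewrite addnAC.
  rewrite (_ : dominant_upto 0 n _) ?andbT //.
  by apply/dominant_uptoP => r k _ kn; lia.
have rowstep r k : (r < n)%N -> (k <= n.-1)%N ->
  tableau_sum (dominant_upto r k) =
  tableau_sum (dominant_upto r 0).
  by move=> rn; elim: k => // k IHk kn; rewrite cancel_step ?IHk //; lia.
have rows r : (r <= n)%N ->
  tableau_sum (dominant_upto 0 n) =
  tableau_sum (dominant_upto r n).
  elim: r => // r IHr rn; rewrite IHr 1?ltnW //.
  transitivity (tableau_sum (dominant_upto r n.-1)).
    apply: eq_bigl => T; congr (_ && _).
    by apply/dominant_uptoP/dominant_uptoP => h r' k' rn' kn' c; apply: h;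
      move: c; lia.
  rewrite rowstep //; apply: eq_bigl => T; congr (_ && _).
  by apply/dominant_uptoP/dominant_uptoP => h r' k' rn' kn' c; apply: h;
      move: c; lia.
rewrite (rows n) //; apply: eq_bigl => T; congr (_ && _).
apply/dominant_uptoP/forallP => [h r|h r k rn kn _].
  by apply/forallP => k; apply/implyP => kn; apply: h; rewrite ?ltn_ord.
by have /forallP/(_ (Ordinal (ltnW kn)))/implyP := h (Ordinal rn); apply.
Qed.

End LRRule.

(** The product of a Schur polynomial with the Vandermonde alternant: Schur
    polynomials are quotients of alternants. *)
Theorem bialternant n la : is_part la -> (size la <= n)%N ->
  alt n (fun j => (n.-1 - j)%N) * schur n la =
  alt n (fun j => (nth 0%N la j + (n.-1 - j))%N).
Proof.
move=> pla sla.
have := @alt_mul_schur_lr n la (fun=> 0%N) pla sla (fun _ _ _ => leqnn 0).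
rewrite (eq_alt (de := fun j => (n.-1 - j)%N)) => [->|//].
have ladec := part_decr pla.
have gtop : gt_pattern n (nth 0%N la) (top_pattern (nth 0%N la)).
  by apply: top_pattern_gt => // j nj; rewrite nth_default // (leq_trans sla).
pose T0 : {ffun cell la -> 'I_n} := [ffun c => Ordinal (leq_trans (cell_rowP c) sla)].
rewrite (big_pred1 (tab T0 (top_pattern (nth 0%N la)))).
  by apply: eq_alt => j jn; rewrite pat_tab // top_pattern_weight.
move=> T; apply/andP/eqP => [[sT dT]|->].
  rewrite -[LHS](tab_pat pla T0 sT); congr tab.
  have gT := pat_gt pla sT.
  have lrT k r : (k.+1 < n)%N -> (r < n)%N -> lr_cond (fun=> 0%N) (pat T) k r.
    move=> kn rn; have /forallP/(_ (Ordinal rn))/forallP/(_ (Ordinal (ltnW kn))) := dT.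
    by move=> /implyP; apply.
  apply: functional_extensionality => i; apply: functional_extensionality => j.
  have [le|lt] := leqP i n; first exact: lr_cond0_top_pattern gT lrT i j le.
  have [[_ e1 _] [_ e2 _]] := (gT, gtop).
  by rewrite e1 ?e2 // ltnW.
split; first exact: tab_semistandard.
apply/forallP => r; apply/forallP => k; apply/implyP => _.
by rewrite pat_tab //; apply: top_pattern_cond.
Qed.

Lemma staircase_decr n (la : nat -> nat) :
  (forall i j, (i <= j)%N -> (j < n)%N -> (la j <= la i)%N) ->
  {in [pred j | (j < n)%N] &,
    {homo (fun j => (la j + (n.-1 - j))%N) : i j / (i < j)%N >-> (j < i)%N}}.
Proof.
move=> ladec i j; rewrite !inE => lti ltj ij.
by have := ladec i j (ltnW ij) ltj; lia.
Qed.

Lemma alt_rho_neq0 n : alt n (fun j => (n.-1 - j)%N) != 0.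
Proof.
have dec := @staircase_decr n (fun=> 0%N) (fun _ _ _ _ => leqnn 0).
have := alt_coef dec dec; rewrite (_ : [forall i, _]); last by apply/forallP.
by apply: contra_eq_neq => -> ; rewrite mcoeff0.
Qed.

Lemma schur_free n d (c : seq nat -> int) : (d <= n)%N ->
  \sum_(mu <- parts_of d) c mu *: schur n mu = 0 ->
  forall mu, mu \in parts_of d -> c mu = 0.
Proof.
move=> dn; have szle nu : nu \in parts_of d -> is_part nu /\ (size nu <= n)%N.
  rewrite mem_parts_of => /andP[pnu /eqP snu]; split=> //.
  by rewrite (leq_trans (size_part_le pnu)) // snu.
move=> /(congr1 (fun p => alt n (fun j => (n.-1 - j)%N) * p)); rewrite mulr0 mulr_sumr.
move=> S0 mu mud; have [pmu smu] := szle mu mud.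
move/mpolyP/(_ [multinom (nth 0%N mu i + (n.-1 - i))%N | i < n]): S0.
have decp nu : is_part nu ->
    forall i j, (i <= j)%N -> (j < n)%N -> (nth 0%N nu j <= nth 0%N nu i)%N.
  by move=> pnu i j ij _; apply: part_decr.
rewrite mcoeff0 raddf_sum /= big_seq_cond.
rewrite (eq_bigr (fun nu => c nu * (nu == mu)%:R)); last first.
  move=> nu /andP[/szle[pnu snu] _]; rewrite -scalerAr bialternant // mcoeffZ.
  rewrite (alt_coef (staircase_decr (decp nu pnu)) (staircase_decr (decp mu pmu))).
  congr (_ * (nat_of_bool _)%:R); apply/forallP/eqP => [h|-> //].
  apply: part_eq => // i; have [lt|ge] := ltnP i n.
    by have := eqP (h (Ordinal lt)) => /= /addIn.
  by rewrite !nth_default // (leq_trans _ ge).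
rewrite -big_seq_cond (bigD1_seq mu) ?parts_of_uniq //= eqxx mulr1 big1 ?addr0 //.
by move=> nu /negbTE->; rewrite mulr0.
Qed.

Lemma schur_coef_inj n d (c c' : seq nat -> int) : (d <= n)%N ->
  \sum_(mu <- parts_of d) c mu *: schur n mu =
  \sum_(mu <- parts_of d) c' mu *: schur n mu ->
  forall mu, mu \in parts_of d -> c mu = c' mu.
Proof.
move=> dn /eqP; rewrite -subr_eq0 -sumrB => /eqP S0 mu mud.
apply/eqP; rewrite -subr_eq0; apply/eqP; move: mu mud.
apply: (schur_free (c := fun mu => c mu - c' mu) dn); rewrite -[RHS]S0.
by apply: eq_bigr => mu _; rewrite scalerBl.
Qed.

(** The partition with parts [f 0, ..., f n.-1] without the trailing zeros, for
    [f] weakly decreasing on these indices. *)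
Definition part_of (n : nat) (f : nat -> nat) : seq nat :=
  mkseq f (\sum_(j < n) (0 < f j)%N).

Section PartOf.

Variables (n : nat) (f : nat -> nat).
Hypothesis fdec : forall i j, (i <= j)%N -> (j < n)%N -> (f j <= f i)%N.

Let m := (\sum_(j < n) (0 < f j))%N.

Let mP : (m <= n)%N /\ forall j, (j < n)%N -> (0 < f j)%N = (j < m)%N.
Proof.
have [|m' -> //] := @sum_down_closed n (fun j => (0 < f j)%N).
by move=> i j ij jn fj; rewrite (leq_trans fj) // fdec.
Qed.

Lemma size_part_of : (size (part_of n f) <= n)%N.
Proof. by rewrite size_mkseq; have [] := mP. Qed.

Lemma nth_part_of j : (j < n)%N -> nth 0%N (part_of n f) j = f j.
Proof.
move=> jn; have [_ /(_ j jn) pj] := mP.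
have [lt|ge] := ltnP j m; first by rewrite nth_mkseq.
by rewrite nth_default ?size_mkseq //; apply/esym/eqP; rewrite -leqn0 leqNgt pj -leqNgt.
Qed.

Lemma is_part_of : is_part (part_of n f).
Proof.
have [mn pm] := mP; apply/andP; split.
  apply/(sortedP 0%N) => i; rewrite size_mkseq -/m => im.
  by rewrite /geq /= !nth_mkseq ?(ltnW im) // fdec // (leq_trans im).
apply/negP => /mapP[j]; rewrite mem_iota /= add0n -/m => jm fj.
by have := pm j (leq_trans jm mn); rewrite -fj jm ltnn.
Qed.

Lemma sumn_part_of : sumn (part_of n f) = psum f n.
Proof.
have [mn pm] := mP; rewrite sumnE /part_of /mkseq big_map -/m.
rewrite -[m in iota 0 m]subn0 -/(index_iota 0 m) big_mkord /psum.
rewrite (big_ord_widen n) //= big_mkcond; apply: eq_bigr => j _.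
by case: ifP => //; rewrite -pm //; case: (f j).
Qed.

End PartOf.

Lemma psum_part n la : (size la <= n)%N -> psum (nth 0%N la) n = sumn la.
Proof.
rewrite /psum; elim: la n => [|x la IHla] n /=.
  by move=> _; rewrite big1 // => i _; rewrite nth_nil.
by case: n => // n sn; rewrite big_ord_recl /= IHla.
Qed.

Lemma psum_gt_weight n b x m : gt_pattern n b x -> (m <= n)%N ->
  psum (gt_weight n x) m = psum (x m) n.
Proof.
move=> gx; elim: m => [|m IHm] mn.
  by rewrite psum0 /psum big1 // => j _; have [-> _ _] := gx.
by rewrite psumS IHm 1?ltnW // subnKC // (psum_level_incr _ gx).
Qed.

(** The number of tableaux of shape [be] and weight [mu - al] whose reverse
    reading word, started at [al], stays dominant. *)
Definition lr_count (n : nat) (al be mu : seq nat) : nat :=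
  #|[pred T : {ffun cell be -> 'I_n} |
      [&& semistandard T, lr_dominant n (nth 0%N al) (pat T) &
          part_of n (fun j => (nth 0%N al j + gt_weight n (pat T) j)%N) == mu]]|.

Section LRProduct.

Variables (n : nat) (al be : seq nat).
Hypotheses (pal : is_part al) (pbe : is_part be).
Hypotheses (sal : (size al <= n)%N) (sbe : (size be <= n)%N).

Lemma lr_dominant_decr x :
  gt_pattern n (nth 0%N be) x -> lr_dominant n (nth 0%N al) x ->
  forall i j, (i <= j)%N -> (j < n)%N ->
  (nth 0%N al j + gt_weight n x j <= nth 0%N al i + gt_weight n x i)%N.
Proof.
move=> gx dx i j; elim: j => [|j IHj]; first by rewrite leqn0 => /eqP->.
rewrite leq_eqVlt => /predU1P[-> //|]; rewrite ltnS => ij jn.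
apply: leq_trans (IHj ij (ltnW jn)).
have n0 : (n.-1 < n)%N by lia.
have /forallP/(_ (Ordinal n0))/forallP/(_ (Ordinal (ltnW jn)))/implyP/(_ jn) := dx.
rewrite /lr_cond /gt_weight /= prednK; last by lia.
have := psum_level_incr n gx jn; have := psum_level_incr n gx (ltnW jn).
have := gt_level_incr n.-1 gx (leqnSn j) (ltnW jn).
have e i' : psum (x i') n = (psum (x i') n.-1 + x i' n.-1)%N.
  by rewrite -psumS prednK //; lia.
by rewrite !e; lia.
Qed.

Theorem schur_mul : schur n al * schur n be =
  \sum_(mu <- parts_of (sumn al + sumn be)) (lr_count n al be mu)%:R *: schur n mu.
Proof.
pose f T j := (nth 0%N al j + gt_weight n (@pat be n T) j)%N.
pose good T := semistandard T && lr_dominant n (nth 0%N al) (@pat be n T).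
have fdec T : good T -> forall i j, (i <= j)%N -> (j < n)%N -> (f T j <= f T i)%N.
  by move=> /andP[sT dT]; apply: lr_dominant_decr => //; apply: pat_gt.
have fparts T : good T -> part_of n (f T) \in parts_of (sumn al + sumn be).
  move=> gT; rewrite mem_parts_of is_part_of ?sumn_part_of; try exact: fdec.
  have /andP[sT _] := gT; have gx := pat_gt pbe sT.
  rewrite psumD psum_part // (psum_gt_weight gx) //; have [_ xn _] := gx.
  by rewrite (eq_psum (fun j _ => xn n j (leqnn n))) psum_part // eqxx.
have -> : schur n al * schur n be = \sum_(T | good T) schur n (part_of n (f T)).
  apply: (mulfI (alt_rho_neq0 n)); rewrite mulrA bialternant //.
  rewrite (alt_mul_schur_lr pbe sbe (part_decr pal)) mulr_sumr.
  apply: eq_bigr => T gT; have dT := fdec T gT.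
  rewrite bialternant ?is_part_of ?size_part_of //.
  by apply: eq_alt => j jn; rewrite nth_part_of.
have -> : \sum_(T | good T) schur n (part_of n (f T)) =
  \sum_(T | good T)
    \sum_(mu <- parts_of (sumn al + sumn be) | part_of n (f T) == mu) schur n mu.
  apply: eq_bigr => T gT; rewrite big_mkcond.
  rewrite (bigD1_seq _ (fparts T gT)) ?parts_of_uniq //=.
  by rewrite eqxx big1 ?addr0 // => mu; rewrite eq_sym => /negbTE->.
rewrite (exchange_big_dep xpredT) //=; apply: eq_bigr => mu _.
rewrite sumr_const scaler_nat; congr (_ *+ _).
by apply: eq_card => T; rewrite !inE /good andbA.
Qed.

End LRProduct.

(** * Uniformity in the number of variables *)

Section Specialization.

Variables (m n : nat).
Hypothesis (nm : (n <= m)%N).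

(** Setting the variables of index at least [n] to zero. *)
Let spec (p : {mpoly int[m]}) : {mpoly int[n]} :=
  p \mPo [tuple (if insub (val i) is Some j then 'X_j else 0) | i < m].

Let specX (i : 'I_m) : spec 'X_i = if insub (val i) is Some j then 'X_j else 0.
Proof. by rewrite /spec comp_mpolyXU -tnth_nth tnth_mktuple. Qed.

Let specM p q : spec (p * q) = spec p * spec q.
Proof. exact: rmorphM. Qed.

Let spec_comb (I : Type) (r : seq I) (c : I -> int) (p : I -> {mpoly int[m]}) :
  spec (\sum_(i <- r) c i *: p i) = \sum_(i <- r) c i *: spec (p i).
Proof. by rewrite /spec linear_sum; apply: eq_bigr => i _; apply: linearZ. Qed.

Let emb (be : seq nat) (T : {ffun cell be -> 'I_n}) : {ffun cell be -> 'I_m} :=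
  [ffun c => widen_ord nm (T c)].

Let emb_inj be : injective (@emb be).
Proof.
move=> S T /ffunP e; apply/ffunP => c; have := e c; rewrite !ffunE => h.
by apply: val_inj; apply: (congr1 val h).
Qed.

Lemma spec_schur la : spec (schur m la) = schur n la.
Proof.
have sX := specX; rewrite /schur /spec in sX *; rewrite raddf_sum /=.
under eq_bigr => T _ do rewrite rmorph_prod /=.
rewrite (bigID (fun T : {ffun cell la -> 'I_m} => [forall c, (T c < n)%N])) /=.
rewrite addrC big1 ?add0r; last first.
  move=> T /andP[_ /forallPn[c]]; rewrite -leqNgt => nT.
  by rewrite (bigD1 c) //= sX insubF ?mul0r // ltnNge nT.
rewrite (eq_bigl (mem ((@emb la) @: [set S | semistandard S]))); last first.
  move=> T; apply/andP/imsetP => [[sT /forallP lt]|[S]].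
    exists [ffun c => Ordinal (lt c)].
      rewrite inE; apply/forallP => c; apply/forallP => d; rewrite !ffunE /=.
      by move/forallP/(_ c)/forallP: sT; apply.
    by apply/ffunP => c; rewrite !ffunE; apply: val_inj.
  rewrite inE => sS ->; split.
    apply/forallP => c; apply/forallP => d; rewrite !ffunE /=.
    by move/forallP/(_ c)/forallP: sS; apply.
  by apply/forallP => c; rewrite ffunE /=.
rewrite big_imset /=; last by move=> S T _ _; apply: emb_inj.
apply: eq_big => [S|S _]; first by rewrite inE.
apply: eq_bigr => c _; rewrite ffunE sX /=.
by rewrite insubT //= => lt; congr 'X_ _; apply: val_inj.
Qed.

Lemma schur_mul_spec (al be : seq nat) (d : nat) (c : seq nat -> int) :
  schur m al * schur m be = \sum_(mu <- parts_of d) c mu *: schur m mu ->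
  schur n al * schur n be = \sum_(mu <- parts_of d) c mu *: schur n mu.
Proof.
move/(congr1 spec); rewrite specM spec_comb !spec_schur => ->.
by apply: eq_bigr => mu _; rewrite spec_schur.
Qed.

End Specialization.

Lemma schur_expansion_lr_count al be : is_part al -> is_part be ->
  schur_expansion al be
    (fun mu => (lr_count (sumn al + sumn be).+1 al be mu)%:R).
Proof.
move=> pal pbe n; set d := (sumn al + sumn be)%N; set N := d.+1.
have sizes k : (d <= k)%N -> (size al <= k)%N /\ (size be <= k)%N.
  by have := size_part_le pal; have := size_part_le pbe; rewrite /d; lia.
have [sal sbe] := sizes N (leqnSn d).
have eN := schur_mul pal pbe sal sbe.
have [nN|/ltnW Nn] := leqP n N; first exact: (schur_mul_spec nN eN).
have [sal' sbe'] := sizes n (leq_trans (leqnSn d) Nn).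
have en := schur_mul pal pbe sal' sbe'; rewrite en !big_seq.
have e := schur_mul_spec Nn en; rewrite eN in e.
by apply: eq_bigr => mu mud; rewrite (schur_coef_inj (leqnSn d) e mud).
Qed.

(** The Littlewood-Richardson coefficients are the numbers of tableaux counted
    by the Littlewood-Richardson rule. *)
Theorem LRcoefE al be mu : is_part al -> is_part be ->
  mu \in parts_of (sumn al + sumn be) ->
  LRcoef al be mu = (lr_count (sumn al + sumn be).+1 al be mu)%:R.
Proof.
move=> pal pbe mud; have ex := schur_expansion_lr_count pal pbe.
rewrite /LRcoef mud; set c := epsilon _ _.
have ec : schur_expansion al be c.
  by apply: epsilon_spec; eexists; apply: ex.
have e := ec (sumn al + sumn be)%N; rewrite ex in e.
by rewrite (schur_coef_inj (leqnn _) e mud).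
Qed.

Lemma LRcoef_ge0 al be mu : is_part al -> is_part be -> 0 <= LRcoef al be mu.
Proof.
move=> pal pbe; have [mud|mud] := boolP (mu \in parts_of (sumn al + sumn be)).
  by rewrite LRcoefE // ler0n.
by rewrite /LRcoef (negbTE mud).
Qed.

(** * Positivity *)

Lemma part_lr_square n la : is_part la -> (size la <= n)%N -> ~~ odd (sumn la) ->
  lr_square n (nth 0%N la).
Proof.
move=> pla sla ev; have ladec := part_decr pla.
(* The heights of the columns of the diagram. *)
pose s := [seq (\sum_(j < n) (c < nth 0 la j))%N | c <- iota 0 (nth 0%N la 0)].
have sumsE (F : nat -> nat) : (\sum_(a <- s) F a =
    \sum_(c < nth 0 la 0) F (\sum_(j < n) (c < nth 0 la j)))%N.
  by rewrite big_map -[X in iota _ X]subn0 -/(index_iota 0 _) big_mkord.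
have count_lt j : (\sum_(c < nth 0 la 0) (c < nth 0 la j) = nth 0 la j)%N.
  have := ladec 0 j (leq0n j); move: (nth 0%N la 0) (nth 0%N la j) => a b ba.
  elim: a ba => [|a IHa]; first by rewrite leqn0 big_ord0 => /eqP.
  rewrite big_ord_recr /= leq_eqVlt ltnS => /predU1P[->|ba].
    rewrite ltnSn addn1 (eq_bigr (fun=> 1%N)) => [|c _]; last by rewrite ltnS ltnW.
    by rewrite sum_nat_const card_ord muln1.
  by rewrite IHa // ltnNge ba addn0.
have alls : all (fun a => a <= n)%N s.
  apply/allP => a /mapP[c _ ->]; rewrite -[X in (_ <= X)%N]card_ord -sum1_card.
  by apply: leq_sum => j _; apply: leq_b1.
have sums : sumn s = sumn la.
  rewrite sumnE sumsE exchange_big /= -(psum_part sla).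
  by apply: eq_bigr => j _; apply: count_lt.
apply: (eq_lr_square _ (lr_square_cols alls _)) => [j jn|]; last by rewrite sums.
rewrite sumsE -[RHS]count_lt; apply: eq_bigr => c _.
rewrite (@lt_sum_down_closed n (fun j => c < nth 0 la j)%N) //.
by move=> i k ik _ lt; apply: leq_trans lt (ladec _ _ ik).
Qed.

Lemma LRcoef_square_gt0 la : is_part la -> ~~ odd (sumn la) ->
  exists2 al, is_part al & 0 < LRcoef al al la.
Proof.
move=> pla ev; set N := (sumn la).+1.
have sla : (size la <= N)%N by apply: leqW; apply: size_part_le.
have [al [x [aldec al0 gx cx laE]]] := part_lr_square pla sla ev.
have aldecN i j : (i <= j)%N -> (j < N)%N -> (al j <= al i)%N by move=> /aldec.
pose a := part_of N al; have pa : is_part a := is_part_of aldecN.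
have aE : nth 0%N a = al.
  apply: functional_extensionality => j; have [jN|Nj] := ltnP j N.
    exact: nth_part_of.
  by rewrite al0 // nth_default // (leq_trans (size_part_of aldecN)).
have sumaE : (sumn a + sumn a)%N = sumn la.
  rewrite (sumn_part_of aldecN) -(psum_part sla) (eq_psum laE) psumD.
  rewrite (psum_gt_weight gx) //; congr (_ + _)%N.
  by have [_ xn _] := gx; apply: eq_psum => j _; rewrite xn.
exists a => //; rewrite LRcoefE //; last by rewrite mem_parts_of pla sumaE eqxx.
rewrite ltr0n sumaE -/N; apply/card_gt0P.
exists (tab [ffun=> ord0] x); have gxa : gt_pattern N (nth 0%N a) x by rewrite aE.
rewrite inE pat_tab // tab_semistandard // aE andTb; apply/andP; split.
  by apply/forallP => r; apply/forallP => k; apply/implyP.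
have fE j : (j < N)%N -> (al j + gt_weight N x j = nth 0 la j)%N by move=> /laE->.
have fdec i j : (i <= j)%N -> (j < N)%N ->
    (al j + gt_weight N x j <= al i + gt_weight N x i)%N.
  by move=> ij jN; rewrite !fE ?(leq_ltn_trans ij) // part_decr.
apply/eqP/part_eq => // [|j]; first exact: is_part_of.
have [jN|Nj] := ltnP j N; first by rewrite nth_part_of ?fE.
by rewrite !nth_default // ?(leq_trans sla) // (leq_trans (size_part_of fdec)).
Qed.

Lemma sumr_seq_gt0 (I : eqType) (s : seq I) (F : I -> int) (i : I) :
  i \in s -> (forall j, j \in s -> 0 <= F j) -> 0 < F i -> 0 < \sum_(j <- s) F j.
Proof.
move=> si F0 Fi; rewrite (perm_big _ (perm_to_rem si)) big_cons /=.
rewrite ltr_wpDr // big_seq; apply: sumr_ge0 => j /mem_rem; exact: F0.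
Qed.

Theorem NLnum_gt0 la : is_part la -> ~~ odd (sumn la) -> 0 < NLnum la la la.
Proof.
move=> pla ev; have [al pal al_gt0] := LRcoef_square_gt0 pla ev.
have alP : al \in parts_upto (sumn la).
  by rewrite mem_parts_upto pal (LRcoef_neq0 (lt0r_neq0 al_gt0)) leq_addr.
have pP a : a \in parts_upto (sumn la) -> is_part a.
  by rewrite mem_parts_upto => /andP[].
have term_ge0 a b c : is_part a -> is_part b -> is_part c ->
    0 <= LRcoef a b la * LRcoef a c la * LRcoef b c la.
  by move=> *; rewrite !mulr_ge0 ?LRcoef_ge0.
apply: (sumr_seq_gt0 alP) => [a /pP pa|].
  rewrite big_seq; apply: sumr_ge0 => b /pP pb.
  by rewrite big_seq; apply: sumr_ge0 => c /pP; apply: term_ge0.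
apply: (sumr_seq_gt0 alP) => [b /pP pb|].
  by rewrite big_seq; apply: sumr_ge0 => c /pP; apply: term_ge0.
apply: (sumr_seq_gt0 alP) => [c /pP|]; first exact: term_ge0.
by rewrite !mulr_gt0.
Qed.

Theorem corollary4p5 (la : seq nat) (hla : is_part la)
    (heven : sumn la = 0 %[mod 2]) :
  0 < NLnum la la la <->
  (forall k : nat, (1 <= k)%N ->
    0 < NLnum (scale_part k la) (scale_part k la) (scale_part k la)).
Proof.
have ev : ~~ odd (sumn la) by rewrite -eqb0 -modn2 heven.
split=> [_ k k0|_]; apply: NLnum_gt0 => //; first exact: is_part_scale.
rewrite (_ : sumn _ = k * sumn la)%N ?oddM ?negb_and ?ev ?orbT //.
by rewrite !sumnE big_map big_distrr.
Qed.
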